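(* Let $R=k[x_1,\ldots,x_n]$ be a polynomial ring over a field $k$, let $a_1,\ldots,a_n$ be positive integers, and let $I$ be a monomial ideal with $(x_1^{a_1},\ldots,x_n^{a_n})\subset I\subset\overline{(x_1^{a_1},\ldots,x_n^{a_n})}$. Then the birational Veronese index of $I$ with respect to its only Rees valuation is equal to $1$.
   Context: $\overline{J}$ denotes the integral closure of an ideal $J$. Let $\mathcal R=R[It]\subset R[t]$ be the Rees ring of $I$ and $\overline{\mathcal R}=\bigoplus_{j\ge0}\overline{I^j}t^j$ its integral closure; the Rees valuations of $I$ are the normalized valuations of the discrete valuation rings $\overline{\mathcal R}_{\mathfrak Q}$, $\mathfrak Q$ ranging over the minimal primes of $I\overline{\mathcal R}$. An ideal $I$ as in the claim has exactly one Rees valuation $v$, namely the monomial valuation with $v(x_i)=L/a_i$, where $L=\operatorname{lcm}(a_1,\ldots,a_n)$, and $v(I)=L$. Birational Veronese index: put $d=v(I)$, grade $R$ by $\deg x_i=v(x_i)$, and denote graded components of ideals by subscripts. Let $C=\bigoplus_{j\ge0}C_j\subset R$ with $C_j=(\overline{I^j})_{jd}$, and $C^{(s)}=\bigoplus_{j\ge0}C_{sj}$. The birational Veronese index of $I$ relative to $v$ is the least positive integer $s$ such that $\operatorname{Quot}(C^{(s)})=\operatorname{Quot}(k[C_s])$, where $\operatorname{Quot}$ denotes the fraction field and $k[C_s]$ the $k$-subalgebra generated by $C_s$. *)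

(* Defs.v *)
From HB Require Import structures.
From mathcomp Require Import all_boot all_order all_algebra.
From mathcomp Require Import fraction.
From mathcomp.multinomials Require Export mpoly.

Set Implicit Arguments.
Unset Strict Implicit.
Unset Printing Implicit Defensive.

Import Order.TTheory GRing.Theory Num.Theory.
Local Open Scope ring_scope.

(* Subsets of a ring are Prop-valued predicates, since membership in an
   integral closure or in a prime ideal of the Rees ring need not come with a
   boolean test. A subring B of A is such a predicate, and the notions of
   ideal below are relative to B; the whole ring is [whole]. *)
Section Ideals.
Variable A : comNzRingType.
Implicit Types (B J P Q S : A -> Prop).

Definition whole : A -> Prop := fun _ => True.

Definition ideal_of B J : Prop :=
  [/\ forall x, J x -> B x,
      J 0,
      forall x y, J x -> J y -> J (x + y)
    & forall b x, B b -> J x -> J (b * x)].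

Definition prime_ideal_of B Q : Prop :=
  [/\ ideal_of B Q,
      ~ Q 1
    & forall x y, B x -> B y -> Q (x * y) -> Q x \/ Q y].

Definition minimal_prime_over B J Q : Prop :=
  [/\ prime_ideal_of B Q,
      forall x, J x -> Q x
    & forall P, prime_ideal_of B P -> (forall x, J x -> P x) ->
        (forall x, P x -> Q x) -> forall x, Q x -> P x].

Definition ideal_gen B S : A -> Prop := fun f =>
  exists2 s : seq (A * A),
    forall p, p \in s -> B p.1 /\ S p.2 & f = \sum_(p <- s) p.1 * p.2.

Definition ideal_pow J (j : nat) : A -> Prop :=
  ideal_gen whole (fun f =>
    exists2 g : 'I_j -> A, forall i, J (g i) & f = \prod_(i < j) g i).

Definition int_closure J : A -> Prop := fun f =>
  exists m : nat, exists c : nat -> A,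
    [/\ (0 < m)%N,
        forall i, (1 <= i <= m)%N -> ideal_pow J i (c i)
      & f ^+ m + \sum_(1 <= i < m.+1) c i * f ^+ (m - i) = 0].

End Ideals.

Section Fractions.
Variable A : idomainType.

Definition inFrac (f : A) : {fraction A} := FracField.tofrac f.

(* The localization B_Q, inside the fraction field of the ambient ring. *)
Definition localization (B Q : A -> Prop) : {fraction A} -> Prop := fun x =>
  exists f, exists g, [/\ B f, B g, ~ Q g & x = inFrac f / inFrac g].

Definition Quot (B : A -> Prop) : {fraction A} -> Prop := fun x =>
  exists f, exists g, [/\ B f, B g, g != 0 & x = inFrac f / inFrac g].

End Fractions.

(* A surjective discrete valuation. The value at 0 is meant to be +oo, which
   int does not contain: v 0 is a dummy value that is never used. *)
Definition normalized_valuation (F : fieldType) (v : F -> int) : Prop :=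
  [/\ forall x y, x != 0 -> y != 0 -> v (x * y) = v x + v y,
      forall x y, x != 0 -> y != 0 -> x + y != 0 ->
        Num.min (v x) (v y) <= v (x + y)
    & exists2 x, x != 0 & v x = 1].

Definition valuation_ring (F : fieldType) (v : F -> int) : F -> Prop :=
  fun x => x = 0 \/ 0 <= v x.

Section ReesValuations.
Variable R : idomainType.

(* The integral closure of R[It]: polynomials in t over R whose coefficient
   of t^j lies in the integral closure of I^j. *)
Definition normalized_Rees (I : R -> Prop) : {poly R} -> Prop :=
  fun p => forall j : nat, int_closure (ideal_pow I j) p`_j.

Definition extended_ideal (I : R -> Prop) : {poly R} -> Prop :=
  ideal_gen (normalized_Rees I) (fun p => exists2 f, I f & p = f%:P).

(* The Rees valuations are valuations of the fraction field of R[t]. *)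
Definition is_Rees_valuation (I : R -> Prop) (v : {fraction {poly R}} -> int)
    : Prop :=
  normalized_valuation v /\
  exists2 Q : {poly R} -> Prop,
    minimal_prime_over (normalized_Rees I) (extended_ideal I) Q
  & forall x, valuation_ring v x <-> localization (normalized_Rees I) Q x.

Definition restrict_val (v : {fraction {poly R}} -> int) : R -> int :=
  fun f => v (inFrac f%:P).

Definition ideal_value (v : R -> int) (I : R -> Prop) (d : int) : Prop :=
  (exists f, [/\ I f, f != 0 & v f = d]) /\
  (forall f, I f -> f != 0 -> d <= v f).

End ReesValuations.

Section PolynomialRing.
Variables (k : fieldType) (n : nat).
Local Notation R := {mpoly k[n]}.
Implicit Types (I : R -> Prop) (v : R -> int).

Definition monomial_ideal I : Prop :=
  exists S : 'X_{1..n} -> Prop, forall f,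
    I f <-> ideal_gen (@whole R) (fun g => exists2 m, S m & g = 'X_[m]) f.

Definition pure_power_ideal (a : 'I_n -> nat) : R -> Prop :=
  ideal_gen (@whole R) (fun g => exists i : 'I_n, g = 'X_i ^+ a i).

(* Homogeneity of degree e for the grading deg x_i = v(x_i). *)
Definition v_homog v (e : int) (f : R) : Prop :=
  forall m, m \in msupp f -> \sum_(i < n) v 'X_i *+ m i = e.

Inductive subalg_gen (S : R -> Prop) : R -> Prop :=
  | subalg_incl f : S f -> subalg_gen S f
  | subalg_const (c : k) : subalg_gen S c%:MP
  | subalg_add f g : subalg_gen S f -> subalg_gen S g -> subalg_gen S (f + g)
  | subalg_mul f g : subalg_gen S f -> subalg_gen S g -> subalg_gen S (f * g).

Definition C_comp I v (d : int) (j : nat) : R -> Prop := fun f =>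
  int_closure (ideal_pow I j) f /\ v_homog v (d *+ j) f.

Definition C_veronese I v (d : int) (s : nat) : R -> Prop := fun f =>
  exists m : nat, exists2 g : nat -> R,
    forall j, C_comp I v d (s * j) (g j) & f = \sum_(j < m) g j.

Definition birational_at I v (d : int) (s : nat) : Prop :=
  forall x, Quot (C_veronese I v d s) x <-> Quot (subalg_gen (C_comp I v d s)) x.

Definition birational_Veronese_index I v (s : nat) : Prop :=
  exists2 d : int, ideal_value v I d &
    [/\ (0 < s)%N, birational_at I v d s
      & forall s', (0 < s')%N -> birational_at I v d s' -> (s <= s')%N].

End PolynomialRing.

(* Main.v *)
From HB Require Import structures.
Require Import Defs.
From mathcomp Require Import all_boot all_order all_algebra.
From mathcomp Require Import fraction generic_quotient.
From mathcomp Require Import ring zify.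

(** Put L = lcm(a_1, ..., a_n) and w_i = L / a_i, so that w_i a_i = L, and give
    x^m t^j the bidegree w.m - L j. On R[t], taking the least bidegree of a
    monomial in the support is a valuation: it is multiplicative because the
    product of the lowest homogeneous parts of p and q is nonzero and lies in a
    single bidegree ([mvalM]). Its extension to the fraction field is the Rees
    valuation of I, and its restriction to R is the monomial valuation
    v(x_i) = w_i.

    The integral closure of I^j consists of the polynomials all of whose
    monomials have weight at least L j. An equation of integral dependence
    cannot hold below that weight ([int_closure_supp]). Conversely,
    (x^m)^L = prod_i (x_i^a_i)^(w_i m_i) is a product of w.m pure powers, so
    x^m t^j is integral over the Rees algebra of the pure powers as soon as
    w.m >= L j; sums of integral elements are integral, and the coefficient of
    a suitable power of t in an integral equation of f t^j is an integral
    equation of f ([integral_int_closure], [mem_int_closure]). Thus the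
    normalized Rees ring is the part of R[t] of nonnegative value.

    The elements of positive value form a prime ideal Q of that ring. Every
    prime ideal of it containing I contains Q: a monomial of weight at least
    n L is divisible by some x_i^a_i, whence a power of each monomial of
    positive value lies in the extension of I ([center_monomial_power]). So Q
    is the only minimal prime. As gcd(w_1, ..., w_n) = 1, some monomial x^c t^q
    has value 1; hence every value is attained on R[t], and the localization at
    Q is the whole valuation ring. A normalized valuation is determined by its
    ring ([valuation_ring_inj]), which gives uniqueness.

    Finally C_j is spanned by the monomials of weight L j, and it remains to see
    that each of them lies in K = Quot(k[C_1]). Write x ~ y when x / y is in K.
    With h = gcd(a_i, a_j), the monomials x_i^a_i and
    x_i^(a_i - a_i/h) x_j^(a_j/h) both have weight L, so
    x_i^(a_i/h) ~ x_j^(a_j/h), and a power of this is x_i^(w_j) ~ x_j^(w_i)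
    ([Koszul_ratio]). Since w.c = 1 + L q and x_i^L ~ 1, it follows that
    x_i ~ x_i^(w.c) ~ (x^c)^(w_i): modulo K every monomial x^m is a power of
    x^c, namely (x^c)^(w.m). As (x^c)^L ~ 1, all monomials whose weight is a
    multiple of L lie in K ([monomial_in]). *)

Set Implicit Arguments.
Unset Strict Implicit.
Unset Printing Implicit Defensive.
Import Order.TTheory GRing.Theory Num.Theory.
Local Open Scope ring_scope.

(** * Valuations on a fraction field *)

Section FractionField.
Variable A : idomainType.
Implicit Types (p q : A) (x y : {fraction A}).

Lemma inFracM p q : inFrac (p * q) = inFrac p * inFrac q.
Proof. exact: tofracM. Qed.

Lemma inFracD p q : inFrac (p + q) = inFrac p + inFrac q.
Proof. exact: tofracD. Qed.

Lemma inFrac0 : inFrac (0 : A) = 0.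
Proof. exact: tofrac0. Qed.

Lemma inFrac1 : inFrac (1 : A) = 1.
Proof. exact: tofrac1. Qed.

Lemma inFracX p e : inFrac (p ^+ e) = inFrac p ^+ e.
Proof. exact: tofracXn. Qed.

Lemma inFrac_eq0 p : (inFrac p == 0) = (p == 0).
Proof. exact: tofrac_eq0. Qed.

Lemma inFrac_inj : injective (@inFrac A).
Proof. by move=> p q /eqP; rewrite tofrac_eq => /eqP. Qed.

Lemma frac_numden x : x = inFrac \n_(repr x) / inFrac \d_(repr x).
Proof.
set r := repr x; have d0 : \d_r != 0 by apply: denom_ratioP.
have dF0 : inFrac \d_r != 0 by rewrite inFrac_eq0.
apply: (canRL (mulfK dF0)).
rewrite -[x]reprK -/r /inFrac.
rewrite -[LHS]/(FracField.mul (\pi r)%qT (FracField.tofrac \d_r)).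
rewrite !piE; apply/eqmodP; rewrite /= FracField.equivfE /FracField.mulf.
by rewrite !numden_Ratio ?oner_eq0 ?mulf_neq0 ?mulr1 ?oner_eq0 // mulrC.
Qed.

End FractionField.

Section ExtendValuation.
Variables (A : idomainType) (u : A -> int).
Implicit Types (p q : A) (x y : {fraction A}).
Hypothesis uM : forall p q, p != 0 -> q != 0 -> u (p * q) = u p + u q.
Hypothesis uD : forall p q, p != 0 -> q != 0 -> p + q != 0 ->
  Num.min (u p) (u q) <= u (p + q).

Definition frac_val (x : {fraction A}) : int :=
  u \n_(repr x) - u \d_(repr x).

Lemma frac_val_div p q : p != 0 -> q != 0 ->
  frac_val (inFrac p / inFrac q) = u p - u q.
Proof.
move=> p0 q0; set x := _ / _.
have := frac_numden x; rewrite /frac_val; set r := repr x => xE.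
have d0 : \d_r != 0 by apply: denom_ratioP.
have E : p * \d_r = \n_r * q.
  apply: inFrac_inj; rewrite !inFracM.
  by apply/eqP; rewrite -eqr_div ?inFrac_eq0 // -xE.
have n0 : \n_r != 0.
  apply: contra_neq p0 => n0; move/eqP: E.
  by rewrite n0 mul0r mulf_eq0 (negbTE d0) orbF => /eqP.
have := congr1 u E; rewrite !uM //; lia.
Qed.

Lemma frac_val_inFrac p : p != 0 -> frac_val (inFrac p) = u p.
Proof.
move=> p0; rewrite -[inFrac p]divr1 -inFrac1 frac_val_div ?oner_eq0 //.
suff -> : u 1 = 0 by rewrite subr0.
have := uM (oner_neq0 A) (oner_neq0 A); rewrite mulr1 => h.
by apply: (addrI (u 1)); rewrite addr0 -h.
Qed.

Lemma frac_ind (P : {fraction A} -> Prop) :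
  P 0 -> (forall p q, p != 0 -> q != 0 -> P (inFrac p / inFrac q)) ->
  forall x, P x.
Proof.
move=> P0 Pdiv x; rewrite (frac_numden x).
have [->|n0] := eqVneq (\n_(repr x)) 0; first by rewrite inFrac0 mul0r.
by apply: Pdiv => //; apply: denom_ratioP.
Qed.

Lemma frac_valM x y : x != 0 -> y != 0 ->
  frac_val (x * y) = frac_val x + frac_val y.
Proof.
elim/frac_ind: x => [|p q p0 q0]; first by rewrite eqxx.
elim/frac_ind: y => [|p' q' p0' q0']; first by rewrite eqxx.
move=> _ _; rewrite mulf_div -!inFracM !frac_val_div ?mulf_neq0 // !uM //; lia.
Qed.

Lemma frac_valD x y : x != 0 -> y != 0 -> x + y != 0 ->
  Num.min (frac_val x) (frac_val y) <= frac_val (x + y).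
Proof.
elim/frac_ind: x => [|p q p0 q0]; first by rewrite eqxx.
elim/frac_ind: y => [|p' q' p0' q0']; first by rewrite eqxx.
move=> _ _; rewrite addf_div ?inFrac_eq0 // -!inFracM -inFracD.
have [->|s0] := eqVneq (p * q' + p' * q) 0; first by rewrite inFrac0 mul0r eqxx.
move=> _; rewrite !frac_val_div ?mulf_neq0 //.
have := uD (mulf_neq0 p0 q0') (mulf_neq0 p0' q0) s0.
rewrite !uM // !ge_min.
by move: (u p) (u q) (u p') (u q') (u (_ + _)) => a b c d e; lia.
Qed.

End ExtendValuation.

(** * The bidegree valuation on R[t] *)

Section MonomialValuation.
Variables (k : fieldType) (n : nat) (w : 'I_n -> nat) (L : nat).
Local Notation R := {mpoly k[n]}.
Local Notation D := {poly R}.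
Implicit Types (p q : D) (P Q T : int -> Prop) (e d : int).

Definition wt (m : 'X_{1..n}) : nat := (\sum_i w i * m i)%N.

Lemma wt0 : wt 0%MM = 0%N.
Proof. by rewrite /wt big1 // => i _; rewrite mnm0E muln0. Qed.

Lemma wtD m1 m2 : wt (m1 + m2)%MM = (wt m1 + wt m2)%N.
Proof.
by rewrite /wt -big_split; apply: eq_bigr => i _; rewrite mnmDE mulnDr.
Qed.

Lemma wtMn m (c : nat) : wt (m *+ c)%MM = (wt m * c)%N.
Proof.
by rewrite /wt big_distrl; apply: eq_bigr => i _; rewrite mulmnE mulnA.
Qed.

Lemma wt1 i : wt U_(i)%MM = w i.
Proof.
rewrite /wt (bigD1 i) //= mnm1E eqxx muln1 big1 ?addn0 // => j ji.
by rewrite mnm1E eq_sym (negbTE ji) muln0.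
Qed.

Definition bideg (j : nat) (m : 'X_{1..n}) : int := (wt m)%:Z - (L * j)%:Z.

Lemma bidegD j1 j2 m1 m2 :
  bideg (j1 + j2) (m1 + m2)%MM = bideg j1 m1 + bideg j2 m2.
Proof. by rewrite /bideg wtD mulnDr; lia. Qed.

(** Stating filtration and homogeneity conditions on supports treats the zero
    polynomial uniformly, whereas its value below is a dummy. *)
Definition supp_in P p : Prop :=
  forall j m, m \in msupp p`_j -> P (bideg j m).

Lemma supp_in0 P : supp_in P 0.
Proof. by move=> j m; rewrite coef0 msupp0. Qed.

Lemma supp_inD P p q : supp_in P p -> supp_in P q -> supp_in P (p + q).
Proof.
move=> Pp Pq j m; rewrite coefD => /msuppD_le; rewrite mem_cat.
by case/orP; [apply: Pp | apply: Pq].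
Qed.

Lemma supp_in_sum P (J : Type) (s : seq J) (B : pred J) (F : J -> D) :
  (forall i, B i -> supp_in P (F i)) -> supp_in P (\sum_(i <- s | B i) F i).
Proof.
move=> PF; elim/big_ind: _ => //; [exact: supp_in0 | exact: supp_inD].
Qed.

(** Both superadditivity of the valuation and homogeneity of products are
    instances: the support of a product lies in the sum of the supports. *)
Lemma supp_inM P Q T p q : (forall d e, P d -> Q e -> T (d + e)) ->
  supp_in P p -> supp_in Q q -> supp_in T (p * q).
Proof.
move=> PQT Pp Qq j m; rewrite coefM => /msupp_sum_le /flattenP [s /mapP[i]].
rewrite mem_filter /= => _ -> /msuppM_le /allpairsP [[m1 m2] /= [h1 h2 ->]].
have -> : j = (i + (j - i))%N by rewrite subnKC // -ltnS.
by rewrite bidegD; apply: PQT; [apply: Pp | apply: Qq].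
Qed.

Lemma supp_in_sub P Q p : (forall d, P d -> Q d) -> supp_in P p -> supp_in Q p.
Proof. by move=> PQ Pp j m /Pp /PQ. Qed.

Lemma supp_inC P (f : R) :
  supp_in P f%:P <-> forall m, m \in msupp f -> P (wt m)%:Z.
Proof.
split=> [Pf m mf|Pf j m].
  by have := Pf 0 m; rewrite coefC eqxx /bideg muln0 subr0; apply.
rewrite coefC; case: eqP => [->|_]; last by rewrite msupp0.
by move/Pf; rewrite /bideg muln0 subr0.
Qed.

Lemma supp_nonzero p : p != 0 -> exists j m, m \in msupp p`_j.
Proof.
move=> p0; exists (size p).-1, (mlead p`_(size p).-1).
by apply: mlead_supp; rewrite -[_`_ _]/(lead_coef p) lead_coef_eq0.
Qed.

Definition weights p : seq int :=
  [seq bideg j m | j <- iota 0 (size p), m <- msupp p`_j].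

Lemma weightsP p d :
  reflect (exists j m, m \in msupp p`_j /\ d = bideg j m) (d \in weights p).
Proof.
apply: (iffP allpairsPdep) => [[j [m [_ mp ->]]]|[j [m [mp ->]]]].
  by exists j, m.
exists j, m; split=> //; rewrite mem_iota /= add0n ltnNge.
by apply: contraL mp => le; rewrite nth_default // msupp0.
Qed.

Definition mval p : int := head 0 (sort <=%R (weights p)).

Lemma mval_min p : supp_in (fun d => mval p <= d) p.
Proof.
move=> j m mp; have := sort_le_sorted (weights p).
have : bideg j m \in sort <=%R (weights p).
  by rewrite mem_sort; apply/weightsP; exists j, m.
rewrite /mval; case: (sort _ _) => //= x s; rewrite inE => /predU1P[->//|ms].
by move/(order_path_min le_trans)/allP; apply.
Qed.

Lemma mval_attained p : p != 0 ->
  exists j m, m \in msupp p`_j /\ bideg j m = mval p.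
Proof.
move=> /supp_nonzero[j0 [m0 mp0]].
have : mval p \in weights p.
  have : bideg j0 m0 \in weights p by apply/weightsP; exists j0, m0.
  rewrite -(mem_sort <=%R _ (bideg _ _)) -(mem_sort <=%R _ (mval p)) /mval.
  case: (sort _ _) => //= x s _.
  exact: mem_head.
by case/weightsP => j [m [mp E]]; exists j, m.
Qed.

Lemma mval_geP p e : p != 0 -> supp_in (fun d => e <= d) p <-> e <= mval p.
Proof.
move=> p0; split=> [ep|le].
  by have [j [m [mp <-]]] := mval_attained p0; apply: ep.
by move=> j m /mval_min; apply: le_trans.
Qed.

Lemma mval_eq p e : p != 0 -> supp_in (fun d => d = e) p -> mval p = e.
Proof.
by move=> p0 ep; have [j [m [mp <-]]] := mval_attained p0; apply: ep.
Qed.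

Definition homog_part (e : int) p : D :=
  \poly_(j < size p)
    \sum_(m <- msupp p`_j | bideg j m == e) p`_j@_m *: 'X_[m].

Lemma coef_homog_part e p j m :
  (homog_part e p)`_j@_m = if bideg j m == e then p`_j@_m else 0.
Proof.
rewrite coef_poly; case: ltnP => [_|le]; last first.
  by rewrite [p`_j]nth_default // mcoeff0 if_same.
rewrite raddf_sum /=.
under eq_bigr => i _ do rewrite mcoeffZ mcoeffX mulr_natr mulrb.
rewrite -big_mkcondr /=.
have [mp|mp] := boolP (m \in msupp p`_j); last first.
  rewrite big_seq_cond big1 => [|i /andP[mi /andP[_ /eqP im]]].
    by rewrite (memN_msupp_eq0 mp) if_same.
  by rewrite -im mi in mp.
case: ifP => [me|mne]; last first.
  by rewrite big1 // => i /andP[ie /eqP im]; rewrite -im ie in mne.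
rewrite (big_rem m) //= me eqxx /= big_seq_cond big1 ?addr0 //.
move=> i /andP[mi /andP[_ /eqP im]].
by move: mi; rewrite im mem_rem_uniq ?msupp_uniq // inE eqxx.
Qed.

Lemma homog_partP e p : supp_in (fun d => d = e) (homog_part e p).
Proof.
move=> j m; rewrite mcoeff_msupp coef_homog_part.
by case: ifP => [/eqP//|_]; rewrite eqxx.
Qed.

Lemma homog_part_mval_neq0 p : p != 0 -> homog_part (mval p) p != 0.
Proof.
move=> p0; have [j [m [mp E]]] := mval_attained p0.
apply: contraTneq mp => z; rewrite mcoeff_msupp.
have := coef_homog_part (mval p) p j m.
by rewrite z coef0 mcoeff0 E eqxx => <-; rewrite eqxx.
Qed.

Lemma sub_homog_part_mval p :
  supp_in (fun d => mval p < d) (p - homog_part (mval p) p).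
Proof.
move=> j m; rewrite mcoeff_msupp coefB mcoeffB coef_homog_part.
case: ifPn => [_|/eqP ne]; first by rewrite subrr eqxx.
rewrite subr0 -mcoeff_msupp => /mval_min; rewrite le_eqVlt => /predU1P[E|//].
by case: ne.
Qed.

(** The bidegree reached by the product of the lowest homogeneous parts,
    which is nonzero since R[t] is a domain, cannot be cancelled by the other
    terms of p q: they have larger bidegree. *)
Lemma mvalM (p q : (D : idomainType)) :
  p != 0 -> q != 0 -> mval (p * q) = mval p + mval q.
Proof.
move=> p0 q0; set p' := homog_part (mval p) p; set q' := homog_part (mval q) q.
have [j [m mpq]] := supp_nonzero
  (mulf_neq0 (homog_part_mval_neq0 p0) (homog_part_mval_neq0 q0)).
have prod : supp_in (fun d => d = mval p + mval q) (p' * q').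
  by apply: supp_inM _ (@homog_partP _ _) (@homog_partP _ _) => d e -> ->.
have E := prod _ _ mpq.
have rest : supp_in (fun d => mval p + mval q < d) (p * q - p' * q').
  have -> : p * q - p' * q' = p' * (q - q') + (p - p') * q by ring.
  apply: supp_inD.
    apply: supp_inM _ (@homog_partP _ _) (@sub_homog_part_mval q) => d e -> ?.
    lia.
  by apply: supp_inM _ (@sub_homog_part_mval p) (@mval_min q) => d e ? ?; lia.
apply/eqP; rewrite eq_le; apply/andP; split.
  rewrite -E; apply: mval_min; rewrite mcoeff_msupp.
  have : m \notin msupp (p * q - p' * q')`_j.
    by apply/negP => /rest; rewrite E ltxx.
  rewrite mcoeff_msupp negbK coefB mcoeffB subr_eq0 => /eqP ->.
  by rewrite -mcoeff_msupp.
apply/mval_geP; first exact: mulf_neq0.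
by apply: supp_inM _ (@mval_min p) (@mval_min q) => d e ? ?; lia.
Qed.

Lemma mvalD (p q : (D : idomainType)) : p != 0 -> q != 0 -> p + q != 0 ->
  Num.min (mval p) (mval q) <= mval (p + q).
Proof.
move=> p0 q0 s0; apply/(mval_geP _ s0); apply: supp_inD.
  by apply: supp_in_sub (@mval_min p) => d ?; lia.
by apply: supp_in_sub (@mval_min q) => d ?; lia.
Qed.

Definition rees_val : {fraction D} -> int := frac_val mval.

Lemma rees_val_div p q :
  p != 0 -> q != 0 -> rees_val (inFrac p / inFrac q) = mval p - mval q.
Proof. exact: (frac_val_div mvalM). Qed.

Lemma rees_val_inFrac p : p != 0 -> rees_val (inFrac p) = mval p.
Proof. exact: (frac_val_inFrac mvalM). Qed.

Lemma rees_valM x y : x != 0 -> y != 0 ->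
  rees_val (x * y) = rees_val x + rees_val y.
Proof. exact: (frac_valM mvalM). Qed.

Lemma rees_valD x y : x != 0 -> y != 0 -> x + y != 0 ->
  Num.min (rees_val x) (rees_val y) <= rees_val (x + y).
Proof. exact: (frac_valD mvalM mvalD). Qed.

End MonomialValuation.

(** * Powers of ideals and integral closure *)

Section IdealPowers.
Variable A : comNzRingType.
Implicit Types (B J S P : A -> Prop) (f g : A).

Lemma ideal_gen_ind B S P :
    P 0 -> (forall f g, P f -> P g -> P (f + g)) ->
    (forall b f, B b -> S f -> P (b * f)) ->
  forall f, ideal_gen B S f -> P f.
Proof.
move=> P0 PD PM f [s sBS ->]; elim: s sBS => [|[b g] s IH] sBS.
  by rewrite big_nil.
rewrite big_cons; apply: PD.
  by have [] := sBS (b, g) (mem_head _ _); apply: PM.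
by apply: IH => x xs; apply: sBS; rewrite inE xs orbT.
Qed.

Lemma ideal_gen0 B S : ideal_gen B S 0.
Proof. by exists [::]; rewrite ?big_nil. Qed.

Lemma ideal_genD B S f g :
  ideal_gen B S f -> ideal_gen B S g -> ideal_gen B S (f + g).
Proof.
move=> [s sBS ->] [t tBS ->]; exists (s ++ t); last by rewrite big_cat.
by move=> x; rewrite mem_cat => /orP[/sBS|/tBS].
Qed.

Lemma ideal_gen_incl B S b f : B b -> S f -> ideal_gen B S (b * f).
Proof.
by move=> Bb Sf; exists [:: (b, f)]; rewrite ?big_seq1 // => x /[!inE] /eqP ->.
Qed.

Lemma ideal_genM B S b f : (forall x y, B x -> B y -> B (x * y)) ->
  B b -> ideal_gen B S f -> ideal_gen B S (b * f).
Proof.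
move=> BM Bb; move: f; apply: ideal_gen_ind => [|f g IHf IHg|c f Bc Sf].
- by rewrite mulr0; apply: ideal_gen0.
- by rewrite mulrDr; apply: ideal_genD.
by rewrite mulrA; apply: ideal_gen_incl => //; apply: BM.
Qed.

Lemma ideal_powD J j f g :
  ideal_pow J j f -> ideal_pow J j g -> ideal_pow J j (f + g).
Proof. exact: ideal_genD. Qed.

Lemma ideal_pow_mull J j f g : ideal_pow J j g -> ideal_pow J j (f * g).
Proof. exact: ideal_genM. Qed.

Lemma ideal_pow_sum J j (K : Type) (s : seq K) (Q : pred K) (F : K -> A) :
  (forall i, Q i -> ideal_pow J j (F i)) ->
  ideal_pow J j (\sum_(i <- s | Q i) F i).
Proof.
by move=> JF; elim/big_ind: _ => //; [apply: ideal_gen0 | apply: ideal_powD].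
Qed.

Lemma ideal_pow_prod J j (g : 'I_j -> A) :
  (forall i, J (g i)) -> ideal_pow J j (\prod_(i < j) g i).
Proof.
move=> Jg; rewrite -[\prod_(i < j) _]mul1r.
by apply: ideal_gen_incl => //; exists g.
Qed.

Lemma ideal_pow0 J f : ideal_pow J 0 f.
Proof.
rewrite -[f]mulr1; apply: ideal_pow_mull.
by have := @ideal_pow_prod J 0 (fun=> 1); rewrite big_ord0; apply; case.
Qed.

Lemma ideal_pow1 J f : J f -> ideal_pow J 1 f.
Proof.
by move=> Jf; have := @ideal_pow_prod J 1 (fun=> f); rewrite big_ord1; apply.
Qed.

Lemma ideal_powM J d e f g :
  ideal_pow J d f -> ideal_pow J e g -> ideal_pow J (d + e) (f * g).
Proof.
move=> Jf; move: g; apply: ideal_gen_ind => [|g1 g2|b _ _ [g Jg ->]].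
- by rewrite mulr0; apply: ideal_gen0.
- by rewrite mulrDr; apply: ideal_powD.
rewrite mulrCA; apply: ideal_pow_mull.
move: f Jf; apply: ideal_gen_ind => [|f1 f2|c _ _ [f Jf ->]].
- by rewrite mul0r; apply: ideal_gen0.
- by rewrite mulrDl; apply: ideal_powD.
rewrite -mulrA; apply: ideal_pow_mull.
pose h (i : 'I_(d + e)) := match split i with inl a => f a | inr b => g b end.
have -> : (\prod_(i < d) f i) * (\prod_(i < e) g i) = \prod_i h i.
  rewrite big_split_ord /=; congr (_ * _); apply: eq_bigr => i _;
  by rewrite /h ?(unsplitK (inl i)) ?(unsplitK (inr i)).
by apply: ideal_pow_prod => i; rewrite /h; case: (split i).
Qed.

(** Group the i j factors of a generator into i blocks of j factors. *)
Lemma ideal_pow_pow J i j f :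
  ideal_pow J (i * j) f -> ideal_pow (ideal_pow J j) i f.
Proof.
elim: i f => [|i IH] f; first by rewrite mul0n => _; apply: ideal_pow0.
rewrite mulSn; apply: ideal_gen_ind => [|f1 f2|b _ _ [g Jg ->]].
- exact: ideal_gen0.
- exact: ideal_powD.
apply: ideal_pow_mull; rewrite big_split_ord -add1n.
apply: ideal_powM; first by apply: ideal_pow1; apply: ideal_pow_prod.
by apply: IH; apply: ideal_pow_prod.
Qed.

End IdealPowers.

Section Closure.
Variables (k : fieldType) (n : nat) (w : 'I_n -> nat) (L : nat).
Local Notation R := {mpoly k[n]}.
Implicit Types (I J : R -> Prop) (f : R).

Local Notation geq_supp e := (supp_in w L (fun d : int => e <= d)).

Lemma geq_suppC f : geq_supp 0 f%:P.
Proof. by apply/supp_inC => m _. Qed.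

(** Constants of R[t] have nonnegative bidegrees, so values can only grow when
    generators are multiplied by arbitrary elements of R. *)
Lemma ideal_pow_supp J (e : int) j f : (forall g, J g -> geq_supp e g%:P) ->
  ideal_pow J j f -> geq_supp (e * j%:Z) f%:P.
Proof.
move=> Je; move: f; apply: ideal_gen_ind => [|f1 f2 H1 H2|b _ _ [g Jg ->]].
- exact: supp_in0.
- by rewrite polyCD; apply: supp_inD.
rewrite polyCM.
apply: (supp_inM (P := fun d => 0 <= d) (Q := fun d => e * j%:Z <= d)).
- by move=> c d ? ?; rewrite -[leLHS]add0r lerD.
- exact: geq_suppC.
elim: j g Jg => [|j IH] g Jg.
  by rewrite big_ord0 mulr0; apply: geq_suppC.
rewrite big_ord_recl polyCM.
apply: (supp_inM (P := fun d => e <= d) (Q := fun d => e * j%:Z <= d)).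
- by move=> c d ? ?; rewrite intS mulrDr mulr1 lerD.
- exact: Je.
exact: IH.
Qed.

Lemma mval1 : mval w L (1 : {poly R}) = 0.
Proof.
apply: mval_eq; first exact: oner_neq0.
by apply/supp_inC => m; rewrite msupp1 inE => /eqP ->; rewrite wt0.
Qed.

Lemma mvalX (p : {poly R}) c : p != 0 -> mval w L (p ^+ c) = mval w L p * c%:Z.
Proof.
move=> p0; elim: c => [|c IH]; first by rewrite expr0 mulr0 mval1.
by rewrite exprS mvalM ?expf_neq0 // IH intS mulrDr mulr1.
Qed.

(** If f had value v < e, every other term c_i f^(M - i) of an equation of
    integral dependence would have value at least e i + v (M - i) > v M, and
    nothing could cancel f^M. *)
Lemma int_closure_supp J (e : int) f :
  (forall g, J g -> geq_supp e g%:P) -> int_closure J f -> geq_supp e f%:P.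
Proof.
move=> Je [M [c [M0 Jc E]]].
have [->|f0] := eqVneq f 0; first exact: supp_in0.
have p0 : f%:P != 0 by rewrite polyC_eq0.
apply/mval_geP => //; rewrite leNgt; apply/negP => lt.
set v := mval w L f%:P in lt.
have ge_f : geq_supp v f%:P by apply: mval_min.
have : v * M%:Z + 1 <= mval w L (f%:P ^+ M).
  apply/mval_geP; first exact: expf_neq0.
  have -> : f%:P ^+ M = \sum_(1 <= i < M.+1) ((- c i)%:P * f%:P ^+ (M - i)).
    rewrite -polyC_exp; move/eqP: E; rewrite addr_eq0 => /eqP ->.
    rewrite -sumrN rmorph_sum; apply: eq_bigr => i _.
    by rewrite -polyC_exp -polyCM mulNr.
  rewrite big_seq_cond; apply: supp_in_sum => i /andP[iM _].
  move: iM; rewrite mem_index_iota ltnS => /andP[i1 iM].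
  apply: (supp_inM (P := fun d => e * i%:Z <= d)
                   (Q := fun d => v * (M - i)%N%:Z <= d)).
  - move=> a b Ha Hb; apply: le_trans (lerD Ha Hb).
    have : (v + 1) * i%:Z <= e * i%:Z by rewrite ler_wpM2r //; lia.
    rewrite -subzn // mulrBr mulrDl mul1r; lia.
  - rewrite -mulN1r; apply: ideal_pow_supp Je _.
    by apply: ideal_pow_mull; apply: Jc; rewrite i1.
  by rewrite -/v; apply/mval_geP; rewrite ?expf_neq0 ?mvalX.
by rewrite mvalX //; lia.
Qed.

End Closure.

Section Integral.
Variables (k : fieldType) (n : nat).
Local Notation R := {mpoly k[n]}.
Variables (I : R -> Prop) (b : 'I_n -> R).
Hypothesis Ib : forall i, I (b i).

(** The image of this map is the Rees algebra R[b_1 t, ..., b_n t]. Presenting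
    the algebra by a ring morphism makes the closure of integral elements under
    sums available. *)
Definition rees_map : {mpoly R[n]} -> {poly R} :=
  mmap (@polyC R) (fun i => (b i)%:P * 'X).

HB.instance Definition _ := GRing.RMorphism.on rees_map.

Definition graded_in (p : {poly R}) := forall d, ideal_pow I d p`_d.

Lemma graded_inC f : graded_in f%:P.
Proof.
move=> d; rewrite coefC.
by case: eqP => [->|_]; [apply: ideal_pow0 | apply: ideal_gen0].
Qed.

Lemma graded_inM p q : graded_in p -> graded_in q -> graded_in (p * q).
Proof.
move=> Ip Iq d; rewrite coefM; apply: ideal_pow_sum => i _.
have id : (i <= d)%N by rewrite -ltnS.
by rewrite -{1}(subnKC id); apply: ideal_powM.
Qed.

Lemma rees_map_graded s : graded_in (rees_map s).
Proof.
rewrite /rees_map /mmap => d; rewrite coef_sum; apply: ideal_pow_sum => m _.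
apply: graded_inM; first exact: graded_inC.
rewrite /mmap1; apply: (big_ind graded_in) => [||i _].
- exact: graded_inC.
- exact: graded_inM.
elim: (m i) => [|c IH]; first exact: graded_inC.
rewrite exprS; apply: graded_inM => // {}d; rewrite coefCM coefX.
case: eqP => [->|_]; first by rewrite mulr1; apply: ideal_pow1.
by rewrite mulr0; apply: ideal_gen0.
Qed.

(** In an integral equation of degree M satisfied by f t^j, the coefficient of
    t^(j M) reads f^M + sum_i c_i f^(M - i) = 0, where c_i is the coefficient
    of t^(j i) in an element of the Rees algebra, hence lies in I^(j i). *)
Lemma integral_int_closure f j :
  integralOver rees_map (f%:P * 'X^j) -> int_closure (ideal_pow I j) f.
Proof.
case=> p p_monic; set q := map_poly _ p => /rootP root_q.
have q_monic : q \is monic by apply: monic_map.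
have q0 : q != 0 by apply: monic_neq0.
set M := (size q).-1; have sizeq : size q = M.+1 by rewrite -polySpred.
have coefq i : graded_in q`_i by rewrite coef_map; apply: rees_map_graded.
have qM : q`_M = 1 by apply/eqP.
(* The condition M > 0 holds as q = 1 has no root. *)
exists M, (fun i => (q`_(M - i))`_(j * i)); split.
- rewrite lt0n; apply/eqP => M0; move: root_q.
  rewrite horner_coef sizeq M0 big_ord1 /=.
  have -> : q`_0 = 1 by rewrite -M0.
  by rewrite mul1r expr0 => /eqP; rewrite oner_eq0.
- by move=> i _; apply: ideal_pow_pow; rewrite mulnC; apply: coefq.
move/(congr1 (fun r : {poly R} => r`_(j * M))): root_q.
rewrite coef0 horner_coef sizeq big_ord_recr /= qM mul1r addrC coefD => E.
rewrite -[RHS]E; congr (_ + _).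
  by rewrite exprMn -polyC_exp coefCM -exprM coefXn eqxx mulr1.
rewrite coef_sum big_add1 big_mkord /= [RHS](reindex_inj rev_ord_inj) /=.
apply: eq_bigr => i _.
have iM := ltn_ord i.
rewrite exprMn mulrA -exprM coefMXn ltn_mul2l -polyC_exp coefMC.
have -> : (j * M - j * (M - i.+1))%N = (j * i.+1)%N by nia.
have -> : (M < M - i.+1)%N = false by lia.
by rewrite andbF.
Qed.

Definition in_rees_image (p : {poly R}) := exists s, p = rees_map s.

Lemma in_rees_imageC f : in_rees_image f%:P.
Proof. by exists f%:MP; rewrite /rees_map mmapC. Qed.

Lemma in_rees_imageM p q :
  in_rees_image p -> in_rees_image q -> in_rees_image (p * q).
Proof. by move=> [s ->] [t ->]; exists (s * t); rewrite rmorphM. Qed.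

Lemma in_rees_image_gen i (e N : nat) :
  (N <= e)%N -> in_rees_image ((b i ^+ e)%:P * 'X^N).
Proof.
move=> /subnK <-; rewrite exprD polyCM -mulrA (polyC_exp N) -exprMn.
apply: in_rees_imageM; first exact: in_rees_imageC.
by exists ('X_i ^+ N); rewrite rmorphXn /= /rees_map mmapX mmap1U.
Qed.

(** Only N of the factors need carry a t; the others are scalars of R. *)
Lemma in_rees_image_prod (s : seq 'I_n) (e : 'I_n -> nat) (N : nat) :
  (N <= \sum_(i <- s) e i)%N ->
  in_rees_image ((\prod_(i <- s) b i ^+ e i)%:P * 'X^N).
Proof.
elim: s N => [|i s IH] N.
  by rewrite !big_nil leqn0 => /eqP ->; rewrite mulr1; apply: in_rees_imageC.
rewrite !big_cons => le; rewrite -[N](subnKC (geq_minl N (e i))).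
rewrite polyCM exprD mulrACA; apply: in_rees_imageM.
  by apply: in_rees_image_gen; apply: geq_minr.
apply: IH; lia.
Qed.

Lemma integral_root_image (z : {poly R}) (e : nat) :
  (0 < e)%N -> in_rees_image (z ^+ e) -> integralOver rees_map z.
Proof.
move=> e0 [s zs]; exists ('X^e - s%:P); first exact: monicXnsubC.
rewrite rmorphB /= map_polyXn map_polyC /= /root !hornerE zs.
by rewrite subrr.
Qed.

End Integral.

Section IntegralClosureOfPowers.
Variables (k : fieldType) (n : nat) (w a : 'I_n -> nat) (L : nat).
Local Notation R := {mpoly k[n]}.
Hypothesis waL : forall i, (w i * a i)%N = L.
Hypothesis L_gt0 : (0 < L)%N.
Variable I : R -> Prop.
Hypothesis I_powers : forall i, I ('X_i ^+ a i).

Lemma monomial_expL m : 'X_[m] ^+ L = \prod_i ('X_i ^+ a i) ^+ (w i * m i) :> R.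
Proof.
rewrite mpolyXE_id -prodrXl; apply: eq_bigr => i _.
by rewrite -!exprM -(waL i); congr (_ ^+ _); rewrite mulnC mulnCA mulnA.
Qed.

(** Each term of f t^j is integral since the L-th power of its monomial is a
    product of at least L j pure powers, times t^(L j). *)
Lemma mem_int_closure f j :
  (forall m, m \in msupp f -> (L * j <= wt w m)%N) ->
  int_closure (ideal_pow I j) f.
Proof.
move=> fj; apply: (integral_int_closure I_powers).
rewrite [f]mpolyE rmorph_sum mulr_suml big_seq.
apply: big_ind => [||m mf]; [exact: integral0|exact: integral_add|].
rewrite -mul_mpolyC rmorphM -mulrA /=; apply: integral_mul.
  have [s ->] := in_rees_imageC (fun i => 'X_i ^+ a i) (f@_m)%:MP.
  exact: integral_id.
apply: (integral_root_image L_gt0).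
rewrite exprMn -polyC_exp monomial_expL -exprM mulnC.
by apply: in_rees_image_prod; apply: fj.
Qed.

End IntegralClosureOfPowers.

(** * The Rees valuation *)

Section ValuationsOfAField.
Variable F : fieldType.
Implicit Types f u v : F -> int.

Lemma valuation1 f : normalized_valuation f -> f 1 = 0.
Proof.
move=> [fM _ _]; have := fM _ _ (oner_neq0 F) (oner_neq0 F).
by rewrite mulr1 => h; apply: (addrI (f 1)); rewrite addr0 -h.
Qed.

Lemma valuationV f x :
  normalized_valuation f -> x != 0 -> f x^-1 = - f x.
Proof.
move=> f_norm x0; have [fM _ _] := f_norm.
have := fM x x^-1 x0; rewrite mulfV // invr_eq0 (valuation1 f_norm) => /(_ x0).
by move=> h; apply: (addrI (f x)); rewrite subrr.
Qed.

Lemma valuationX f x (c : nat) :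
  normalized_valuation f -> x != 0 -> f (x ^+ c) = f x * c%:Z.
Proof.
move=> f_norm x0; have [fM _ _] := f_norm.
elim: c => [|c IH]; first by rewrite expr0 mulr0 valuation1.
by rewrite exprS fM ?expf_neq0 // IH intS mulrDr mulr1.
Qed.

(** Units of the common valuation ring have value 0 for both valuations, so
    dividing x by a power of an element z with v z = 1 gives u x = v x * u z.
    Surjectivity of u and u z >= 0 then force u z = 1. *)
Lemma valuation_ring_inj u v :
  normalized_valuation u -> normalized_valuation v ->
  (forall x, valuation_ring u x <-> valuation_ring v x) ->
  forall x, x != 0 -> u x = v x.
Proof.
move=> u_norm v_norm uv.
have [uM _ [s s0 us]] := u_norm; have [vM _ [z z0 vz]] := v_norm.
have ge x : x != 0 -> (0 <= u x) = (0 <= v x).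
  move=> x0; have [h1 h2] := uv x; apply/idP/idP => h.
    by case: h1 => //; [right | move/eqP; rewrite (negbTE x0)].
  by case: h2 => //; [right | move/eqP; rewrite (negbTE x0)].
have eq0 x : x != 0 -> v x = 0 -> u x = 0.
  move=> x0 vx; have xV0 : x^-1 != 0 by rewrite invr_eq0.
  have := ge _ x0; have := ge _ xV0.
  rewrite !valuationV // vx oppr0 lexx oppr_ge0 => h1 h2.
  by apply/eqP; rewrite eq_le h1 h2.
have prop_nat x (c : nat) : x != 0 -> v x = c%:Z -> u x = c%:Z * u z.
  move=> x0 vx; have y0 : (z ^+ c)^-1 != 0 by rewrite invr_eq0 expf_neq0.
  have := eq0 (x / z ^+ c) (mulf_neq0 x0 y0).
  rewrite uM // vM // !valuationV ?expf_neq0 // !valuationX // vz vx.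
  rewrite mul1r subrr; move/(_ erefl)/eqP; by rewrite subr_eq0 mulrC => /eqP.
have prop x : x != 0 -> u x = v x * u z.
  move=> x0; case vx : (v x) => [c|c]; first exact: prop_nat.
  have := @prop_nat x^-1 c.+1; rewrite invr_eq0 !valuationV // vx.
  by move/(_ x0 erefl); rewrite NegzE mulNr => <-; rewrite opprK.
have uz : 0 <= u z by rewrite ge // vz.
have : v s * u z = 1 by rewrite -prop.
move=> vsuz x x0; rewrite prop //.
have -> : u z = 1.
  by move: (v s) (u z) uz vsuz => i j j0 ij; have [h|h] := lerP 1 i; nia.
by rewrite mulr1.
Qed.

End ValuationsOfAField.

Section ReesValuation.
Variables (k : fieldType) (n : nat) (w a : 'I_n -> nat) (L : nat).
Local Notation R := {mpoly k[n]}.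
Local Notation D := {poly R}.
Hypothesis n_gt0 : (0 < n)%N.
Hypothesis waL : forall i, (w i * a i)%N = L.
Hypothesis L_gt0 : (0 < L)%N.
(* The monomial x^c t^q has value 1. *)
Variables (c : 'X_{1..n}) (q : nat).
Hypothesis wt_c : wt w c = (1 + L * q)%N.
Variable I : R -> Prop.
Hypothesis I_powers : forall i, I ('X_i ^+ a i).
Hypothesis I_supp : forall f, I f -> supp_in w L (fun d => L%:Z <= d) f%:P.

Local Notation val := (mval w L).
Local Notation geq_supp e := (supp_in w L (fun d : int => e <= d)).

Lemma normalized_ReesP p : normalized_Rees I p <-> geq_supp 0 p.
Proof.
split=> [Ip j m mp|p0 j].
  have := int_closure_supp
    (fun g => @ideal_pow_supp k n w L I L%:Z j g I_supp) (Ip j).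
  by move/supp_inC => /(_ _ mp); rewrite /bideg; lia.
apply: (mem_int_closure waL) => // m mp.
by have := p0 j m mp; rewrite /bideg; lia.
Qed.

Lemma normalized_ReesM x y :
  normalized_Rees I x -> normalized_Rees I y -> normalized_Rees I (x * y).
Proof.
move=> /normalized_ReesP x0 /normalized_ReesP y0; apply/normalized_ReesP.
by apply: supp_inM _ x0 y0 => d e; apply: addr_ge0.
Qed.

Lemma normalized_Rees_monomial m j : (L * j <= wt w m)%N ->
  normalized_Rees I (('X_[m])%:P * 'X^j).
Proof.
move=> le; apply/normalized_ReesP => i m'; rewrite coefCM coefXn.
case: eqP => [->|_]; last by rewrite mulr0 msupp0.
by rewrite mulr1 msuppX inE => /eqP ->; rewrite /bideg; lia.
Qed.

Lemma normalized_ReesC f : normalized_Rees I f%:P.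
Proof. by apply/normalized_ReesP; apply: geq_suppC. Qed.

(** The center, in the normalized Rees ring, of the bidegree valuation. *)
Definition center (p : D) : Prop := geq_supp 1 p.

Lemma center_val p : p != 0 -> center p <-> 1 <= val p.
Proof. exact: mval_geP. Qed.

Lemma center_Rees p : center p -> normalized_Rees I p.
Proof.
by move=> p1; apply/normalized_ReesP; apply: supp_in_sub p1 => d; lia.
Qed.

Lemma center_prime : prime_ideal_of (normalized_Rees I) center.
Proof.
split.
- split=> [x||x y|]; [exact: center_Rees|exact: supp_in0|exact: supp_inD|].
  move=> b x /normalized_ReesP b0 x1; by apply: supp_inM _ b0 x1 => d e; lia.
- by move=> /(center_val (oner_neq0 _)); rewrite mval1.
move=> x y /normalized_ReesP x0 /normalized_ReesP y0 xy.
have [->|nx] := eqVneq x 0; first by left; apply: supp_in0.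
have [->|ny] := eqVneq y 0; first by right; apply: supp_in0.
move: x0 y0 xy; rewrite /center !mval_geP ?mulf_neq0 // mvalM //; lia.
Qed.

Lemma extended_ideal_center p : extended_ideal I p -> center p.
Proof.
move: p; apply: ideal_gen_ind => [|f g|b _ /normalized_ReesP b0 [f If ->]].
- exact: supp_in0.
- exact: supp_inD.
by apply: supp_inM _ b0 (I_supp If) => d e; lia.
Qed.

(** Otherwise w_i m_i < w_i a_i = L for all i, so the weight is below n L. *)
Lemma pure_power_dvd m : (n * L <= wt w m)%N -> exists i, (a i <= m i)%N.
Proof.
move=> le; apply/existsP; apply: contraLR le => /existsPn lt.
rewrite -ltnNge; apply: (@leq_ltn_trans (n * L.-1)); last first.
  by rewrite ltn_pmul2l // prednK.
rewrite -[n in (n * _)%N]card_ord -sum_nat_const; apply: leq_sum => i _.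
have := lt i; have := waL i; rewrite -ltnNge; nia.
Qed.

(** The exponent n L serves twice: it raises the weight to at least n L, so
    that a pure power can be split off, and it produces a surplus of at least L
    over L j (n L), which pays for that pure power. *)
Lemma center_monomial_power m j : (L * j < wt w m)%N ->
  extended_ideal I ((('X_[m])%:P * 'X^j) ^+ (n * L)).
Proof.
move=> lt; set N := (n * L)%N; pose m' := (m *+ N)%MM.
have N0 : (0 < N)%N by rewrite muln_gt0 n_gt0.
have wm' : wt w m' = (wt w m * N)%N by rewrite wtMn.
have [i ai] : exists i, (a i <= m' i)%N.
  by apply: pure_power_dvd; rewrite wm' -/N leq_pmull //; lia.
have le : (U_(i) *+ a i <= m')%MM.
  apply/mnm_lepP => l; rewrite mulmnE mnm1E.
  by case: eqP => [<-|_]; rewrite ?mul1n.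
have -> : (('X_[m])%:P * 'X^j) ^+ N =
    (('X_[m' - U_(i) *+ a i])%:P * 'X^(j * N)) * ('X_i ^+ a i)%:P :> D.
  have -> : ('X_[m' - U_(i) *+ a i])%:P * 'X^(j * N) * ('X_i ^+ a i)%:P =
      ('X_[m'])%:P * 'X^(j * N) :> D.
    by rewrite mulrAC -polyCM mpolyXn -mpolyXD submK.
  by rewrite exprMn -polyC_exp mpolyXn -exprM.
apply: ideal_gen_incl; last by exists ('X_i ^+ a i).
apply: normalized_Rees_monomial.
have := congr1 (wt w) (submK le); rewrite wtD wm' wtMn wt1 waL.
rewrite /N; nia.
Qed.

Lemma prime_ideal_root (B P : D -> Prop) z (e : nat) :
    (forall x y, B x -> B y -> B (x * y)) -> B 1 -> prime_ideal_of B P ->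
  B z -> P (z ^+ e) -> P z.
Proof.
move=> BM B1 [_ P1 PM] Bz; elim: e => [/P1//|e IH]; rewrite exprS.
have Bze : B (z ^+ e) by elim: (e) => // d; rewrite exprS; apply: BM.
by case/PM.
Qed.

(** Every term of an element of the center is a constant times a monomial of
    positive value, and a power of that monomial lies in the extended ideal. *)
Lemma center_minimum P : prime_ideal_of (normalized_Rees I) P ->
  (forall x, extended_ideal I x -> P x) -> forall x, center x -> P x.
Proof.
move=> P_prime IP p p1; have [[_ P0 PD PM] _ _] := P_prime.
rewrite -[p]coefK poly_def; apply: big_ind => // j _.
rewrite -mul_polyC [p`_j]mpolyE rmorph_sum mulr_suml big_seq.
apply: big_ind => // m mp; rewrite -mul_mpolyC rmorphM -mulrA /=.
apply: PM; first exact: normalized_ReesC.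
have le : (L * j < wt w m)%N by have := p1 j m mp; rewrite /bideg; lia.
apply: (prime_ideal_root (e := (n * L)%N) _ _ P_prime).
- exact: normalized_ReesM.
- exact: normalized_ReesC.
- by apply: normalized_Rees_monomial; apply: ltnW.
by apply: IP; apply: center_monomial_power.
Qed.

Lemma center_minimal_prime :
  minimal_prime_over (normalized_Rees I) (extended_ideal I) center.
Proof.
split; [exact: center_prime | exact: extended_ideal_center |].
by move=> P P_prime IP _; apply: center_minimum.
Qed.

Lemma minimal_prime_center P :
  minimal_prime_over (normalized_Rees I) (extended_ideal I) P ->
  forall x, P x <-> center x.
Proof.
move=> [P_prime IP P_min] x; split; last exact: center_minimum.
apply: P_min; [exact: center_prime | exact: extended_ideal_center |].
exact: center_minimum.
Qed.

(** Take a power of the monomial x^c t^q, which has value 1, and multiply it by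
    a power of t, of value -L, to reach negative integers. *)
Lemma val_surj (e : int) : exists2 h : D, h != 0 & val h = e.
Proof.
pose N := absz (e + L%:Z * `|e|); pose m := (c *+ N)%MM.
pose h : D := ('X_[m])%:P * 'X^(q * N + `|e|%N).
have h0 : h != 0.
  rewrite mulf_neq0 ?expf_neq0 ?polyX_eq0 // polyC_eq0.
  by rewrite -msupp_eq0 msuppX.
exists h => //; apply: mval_eq => //.
move=> i m'; rewrite coefCM coefXn.
case: eqP => [->|_]; last by rewrite mulr0 msupp0.
rewrite mulr1 msuppX inE => /eqP ->; rewrite /bideg wtMn wt_c.
have N_eq : N%:Z = e + L%:Z * `|e| by rewrite /N gez0_abs //; nia.
nia.
Qed.

Local Notation rees_val := (@rees_val k n w L).

Lemma rees_val_normalized : normalized_valuation rees_val.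
Proof.
split.
- exact: rees_valM.
- exact: rees_valD.
have [h h0 hv] := val_surj 1.
by exists (inFrac h); rewrite ?inFrac_eq0 // rees_val_inFrac.
Qed.

Lemma rees_val_localization x :
  valuation_ring rees_val x <-> localization (normalized_Rees I) center x.
Proof.
have center1 : ~ center 1 by case: center_prime.
split.
  elim/frac_ind: x => [_|p r p0 r0 [/eqP|]].
  - exists 0, 1; rewrite inFrac0 mul0r; split=> //.
      by apply/normalized_ReesP; apply: supp_in0.
    exact: normalized_ReesC.
  - by rewrite mulf_eq0 invr_eq0 !inFrac_eq0 (negbTE p0) (negbTE r0).
  rewrite rees_val_div // => pr.
  (* Multiplying by h makes the denominator a unit of the valuation ring. *)
  have [h h0 hv] := val_surj (- val r).
  exists (p * h), (r * h); split.
  - by apply/normalized_ReesP/mval_geP; rewrite ?mulf_neq0 // mvalM // hv.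
  - by apply/normalized_ReesP/mval_geP; rewrite ?mulf_neq0 // mvalM // hv subrr.
  - by move/(center_val (mulf_neq0 r0 h0)); rewrite mvalM // hv subrr.
  by rewrite !inFracM -mulf_div divff ?mulr1 // inFrac_eq0.
move=> [f [g [/normalized_ReesP f0 /normalized_ReesP g0 ng ->]]].
have [->|nf] := eqVneq f 0; first by left; rewrite inFrac0 mul0r.
have [g_0|ng0] := eqVneq g 0; first by case: ng; rewrite g_0; apply: supp_in0.
right; rewrite rees_val_div //.
have /(mval_geP _ _ _ nf) vf := f0; have /(mval_geP _ _ _ ng0) vg := g0.
have : ~ 1 <= val g by move/(center_val ng0).
lia.
Qed.

Lemma rees_val_is_Rees_valuation : is_Rees_valuation I rees_val.
Proof.
split; first exact: rees_val_normalized.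
by exists center; [exact: center_minimal_prime | exact: rees_val_localization].
Qed.

Lemma Rees_valuation_unique u :
  is_Rees_valuation I u -> forall x, x != 0 -> u x = rees_val x.
Proof.
move=> [u_norm [P P_min uP]].
apply: (valuation_ring_inj u_norm rees_val_normalized) => x.
rewrite uP rees_val_localization; have PE := minimal_prime_center P_min.
by split=> -[f [g [Bf Bg ng ->]]]; exists f, g; split=> // /PE.
Qed.

End ReesValuation.

(** * Weights *)

Section Weights.
Variables (n : nat) (a : 'I_n -> nat).
Hypothesis n_gt0 : (0 < n)%N.
Hypothesis a_gt0 : forall i, (0 < a i)%N.

Definition lcm_exp : nat := \big[lcmn/1%N]_i a i.
Definition weight (i : 'I_n) : nat := (lcm_exp %/ a i)%N.

Lemma lcm_exp_gt0 : (0 < lcm_exp)%N.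
Proof.
by apply: (big_ind (fun x => 0 < x)%N) => // x y x0 y0; rewrite lcmn_gt0 x0.
Qed.

Lemma weight_mul i : (weight i * a i)%N = lcm_exp.
Proof. by apply: divnK; apply: biglcmn_sup (dvdnn _). Qed.

(** A common divisor g of the weights leaves L / g a common multiple of the
    a_i, so L divides L / g. *)
Lemma gcd_weight : \big[gcdn/0%N]_i weight i = 1%N.
Proof.
set g := (X in X = _).
have gw i : (g %| weight i)%N by apply: biggcdn_inf (dvdnn _).
have gL : (g %| lcm_exp)%N.
  by rewrite -(weight_mul (Ordinal n_gt0)); apply: dvdn_mulr.
have : (lcm_exp %| lcm_exp %/ g)%N.
  apply/dvdn_biglcmP => i _; rewrite -(weight_mul i) mulnC.
  by rewrite -muln_divA // dvdn_mulr.
have g0 : (0 < g)%N by apply: dvdn_gt0 lcm_exp_gt0 gL.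
move/dvdn_leq; rewrite divn_gt0 // dvdn_leq ?lcm_exp_gt0 // => /(_ isT).
rewrite leq_divRL // -[leqRHS]muln1 leq_pmul2l ?lcm_exp_gt0 //.
by move=> g1; apply/eqP; rewrite eqn_leq g1.
Qed.

(** Bezout modulo L, which allows nonnegative coefficients: subtracting is
    adding L - 1 times. *)
Lemma weight_combination :
  exists (c : 'X_{1..n}) q, wt weight c = (1 + lcm_exp * q)%N.
Proof.
set L := lcm_exp; have L0 := lcm_exp_gt0 : (0 < L)%N.
have [c cE] : exists c : 'X_{1..n}, wt weight c = 1 %[mod L].
  rewrite -gcd_weight.
  apply: (big_ind (fun x => exists c : 'X_{1..n}, wt weight c = x %[mod L])).
  - by exists 0%MM; rewrite wt0.
  - move=> x y [c1 c1E] [c2 c2E]; have [->|x0] := posnP x.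
      by exists c2; rewrite gcd0n.
    case: (egcdnP y x0) => km kn E _.
    (* km x = kn y + gcd x y, and - kn is replaced by kn (L - 1) modulo L. *)
    exists (c1 *+ km + c2 *+ (kn * L.-1))%MM; rewrite wtD !wtMn.
    have -> : (wt weight c1 * km + wt weight c2 * (kn * L.-1) =
               x * km + y * (kn * L.-1) %[mod L])%N.
      rewrite -modnDm -modnMml c1E modnMml -(modnMml (wt _ c2)) c2E.
      by rewrite modnMml modnDm.
    rewrite -[RHS](modnMDl (kn * y)); congr (_ %% _)%N.
    rewrite [(x * km)%N]mulnC E -[in RHS](prednK L0) mulnS.
    by rewrite mulnCA mulnA addnAC.
  by move=> i _; exists U_(i)%MM; rewrite wt1.
(* For L = 1 the combination c may be 0; adding a pure power, of weight L,
   makes the weight at least 1. *)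
pose i0 := Ordinal n_gt0.
have E : wt weight (c + U_(i0) *+ a i0)%MM = (wt weight c + L)%N.
  by rewrite wtD wtMn wt1 weight_mul.
exists (c + U_(i0) *+ a i0)%MM, ((wt weight c + L - 1) %/ L)%N.
rewrite E mulnC divnK; first by rewrite subnKC // addn_gt0 L0 orbT.
rewrite -eqn_mod_dvd ?modnDr ?cE //.
by rewrite addn_gt0 L0 orbT.
Qed.

End Weights.

(** * The birational Veronese index *)

Section QuotientField.
Variables (A : idomainType) (B : A -> Prop).
Hypotheses (B1 : B 1) (BD : forall f g, B f -> B g -> B (f + g))
  (BM : forall f g, B f -> B g -> B (f * g)).

Lemma Quot_incl f : B f -> Quot B (inFrac f).
Proof. by move=> Bf; exists f, 1; rewrite inFrac1 divr1 oner_eq0. Qed.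

Lemma QuotM x y : Quot B x -> Quot B y -> Quot B (x * y).
Proof.
move=> [f [g [Bf Bg g0 ->]]] [f' [g' [Bf' Bg' g0' ->]]].
exists (f * f'), (g * g'); rewrite mulf_neq0 // mulf_div !inFracM.
by split=> //; apply: BM.
Qed.

Lemma QuotD x y : Quot B x -> Quot B y -> Quot B (x + y).
Proof.
move=> [f [g [Bf Bg g0 ->]]] [f' [g' [Bf' Bg' g0' ->]]].
exists (f * g' + f' * g), (g * g'); rewrite mulf_neq0 //.
rewrite addf_div ?inFrac_eq0 // inFracD !inFracM.
by split=> //; [apply: BD; apply: BM | apply: BM].
Qed.

Lemma QuotV x : Quot B x -> Quot B x^-1.
Proof.
move=> Bx; have [f [g [Bf Bg g0 xE]]] := Bx.
have [f0|f0] := eqVneq f 0.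
  by move: Bx; rewrite xE f0 inFrac0 mul0r invr0.
by exists g, f; rewrite xE invf_div.
Qed.

Lemma Quot_div x y : Quot B x -> Quot B y -> Quot B (x / y).
Proof. by move=> Bx By; apply: QuotM => //; apply: QuotV. Qed.

Lemma Quot_prod (J : Type) (s : seq J) (F : J -> {fraction A}) :
  (forall i, Quot B (F i)) -> Quot B (\prod_(i <- s) F i).
Proof.
move=> BF; apply: big_ind => //; last exact: QuotM.
by rewrite -inFrac1; apply: Quot_incl.
Qed.

Lemma QuotX x (e : nat) : Quot B x -> Quot B (x ^+ e).
Proof.
move=> Bx; elim: e => [|e IH]; last by rewrite exprS; apply: QuotM.
by rewrite expr0 -inFrac1; apply: Quot_incl.
Qed.

End QuotientField.

Section Birational.
Variables (k : fieldType) (n : nat) (w a : 'I_n -> nat) (L : nat).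
Local Notation R := {mpoly k[n]}.
Hypothesis a_gt0 : forall i, (0 < a i)%N.
Hypothesis waL : forall i, (w i * a i)%N = L.
Variables (c : 'X_{1..n}) (q : nat).
Hypothesis wt_c : wt w c = (1 + L * q)%N.
Variable B : R -> Prop.
Hypotheses (B1 : B 1) (BD : forall f g, B f -> B g -> B (f + g))
  (BM : forall f g, B f -> B g -> B (f * g)).
Hypothesis B_C : forall x : k, B x%:MP.
Hypothesis B_mon : forall m, wt w m = L -> B 'X_[m].

Local Notation K := (Quot B).
Local Notation mon m := (inFrac ('X_[m] : R)).

Lemma monM m1 m2 : mon (m1 + m2) = mon m1 * mon m2.
Proof. by rewrite mpolyXD inFracM. Qed.

Lemma monX m (e : nat) : mon (m *+ e) = mon m ^+ e.
Proof. by rewrite -mpolyXn inFracX. Qed.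

Lemma mon_neq0 m : mon m != 0.
Proof. by rewrite inFrac_eq0 -msupp_eq0 msuppX. Qed.

Lemma mon_prod m : mon m = \prod_i mon U_(i) ^+ m i.
Proof.
rewrite mpolyXE_id /inFrac rmorph_prod; apply: eq_bigr => i _.
by rewrite rmorphXn.
Qed.

Lemma mon_ratio m m1 m2 : wt w (m + m1)%MM = L -> wt w (m + m2)%MM = L ->
  K (mon m1 / mon m2).
Proof.
move=> wm1 wm2; exists 'X_[m + m1], 'X_[m + m2].
split; [exact: B_mon | exact: B_mon | by rewrite -msupp_eq0 msuppX |].
by rewrite !monM -mulf_div divff ?mul1r ?mon_neq0.
Qed.

(** Write a_i = al h and a_j = be h with h = gcd(a_i, a_j). Then x_i^al and
    x_j^be have the same weight L / h and are both completed to weight L by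
    x_i^(al (h - 1)), so their ratio is in K. Coprimality of al and be makes the
    claimed ratio a power of that one. These ratios generate all Laurent
    monomials of weight 0 because the weights are coprime. *)
Lemma Koszul_ratio i j : K (mon U_(i) ^+ w j / mon U_(j) ^+ w i).
Proof.
set h := gcdn (a i) (a j).
have h0 : (0 < h)%N by rewrite gcdn_gt0 a_gt0.
have [al aiE] : exists al, a i = (al * h)%N by apply/dvdnP/dvdn_gcdl.
have [be ajE] : exists be, a j = (be * h)%N by apply/dvdnP/dvdn_gcdr.
have al0 : (0 < al)%N by have := a_gt0 i; rewrite aiE muln_gt0 => /andP[].
have cop : coprime al be.
  by rewrite /coprime -(eqn_pmul2r h0) mul1n muln_gcdl -aiE -ajE.
have E : (w i * al = w j * be)%N.
  apply/eqP; rewrite -(eqn_pmul2r h0) -!mulnA -aiE -ajE !waL //.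
have [r wj] : exists r, w j = (r * al)%N.
  by apply/dvdnP; rewrite -(Gauss_dvdl _ cop) -E dvdn_mull.
have wi : w i = (r * be)%N.
  by apply/eqP; rewrite -(eqn_pmul2r al0) E wj mulnAC.
have step : K (mon (U_(i) *+ al)%MM / mon (U_(j) *+ be)%MM).
  apply: (mon_ratio (m := (U_(i) *+ (al * h.-1))%MM)); rewrite wtD !wtMn !wt1.
    by rewrite -mulnDr -mulnSr prednK // -aiE.
  by rewrite -E -mulnDr -mulnSr prednK // -aiE.
rewrite wj wi (mulnC r al) (mulnC r be) !exprM -expr_div_n.
by apply: QuotX => //; rewrite -!monX.
Qed.

Lemma pure_power_in i (e : nat) : K (mon U_(i) ^+ (L * e)).
Proof.
rewrite -(waL i) [(w i * _)%N]mulnC -mulnA exprM; apply: QuotX => //.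
by rewrite -monX; apply: Quot_incl => //; apply: B_mon; rewrite wtMn wt1.
Qed.

(** Modulo K, x_i = x_i^(w.c) = prod_j (x_i^(w_j))^(c_j), and replacing each
    x_i^(w_j) by x_j^(w_i) turns this into (x^c)^(w_i). *)
Lemma variable_ratio i : K (mon U_(i) / mon c ^+ w i).
Proof.
have -> : mon U_(i) / mon c ^+ w i =
    (\prod_j (mon U_(i) ^+ w j / mon U_(j) ^+ w i) ^+ c j)
      / mon U_(i) ^+ (L * q).
  have -> : \prod_j (mon U_(i) ^+ w j / mon U_(j) ^+ w i) ^+ c j =
      mon U_(i) ^+ (1 + L * q) / mon c ^+ w i.
    rewrite -wt_c /wt expr_sum [mon c]mon_prod -prodrXl -prodf_div.
    by apply: eq_bigr => j _; rewrite expr_div_n -!exprM [(c j * _)%N]mulnC.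
  rewrite exprD expr1 mulrAC mulfK // expf_neq0 //; exact: mon_neq0.
apply: Quot_div => //; last exact: pure_power_in.
by apply: Quot_prod => // j; apply: QuotX => //; apply: Koszul_ratio.
Qed.

(** Modulo K, x^m is (x^c)^(w.m) and (x^c)^L is trivial. *)
Lemma monomial_in m : (L %| wt w m)%N -> K (mon m).
Proof.
case/dvdnP => j wm.
have -> : mon m = (\prod_i (mon U_(i) / mon c ^+ w i) ^+ m i)
    * (\prod_i mon U_(i) ^+ (L * c i)) ^+ j.
  have -> : \prod_i mon U_(i) ^+ (L * c i) = mon c ^+ L.
    rewrite [mon c]mon_prod -prodrXl; apply: eq_bigr => i _.
    by rewrite -exprM mulnC.
  under eq_bigr => i _ do rewrite expr_div_n.
  rewrite prodf_div -mon_prod -exprM mulnC -wm.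
  under eq_bigr => i _ do rewrite -exprM.
  by rewrite -expr_sum mulfVK // expf_neq0 // mon_neq0.
apply: QuotM => //.
  by apply: Quot_prod => // i; apply: QuotX => //; apply: variable_ratio.
by apply: QuotX => //; apply: Quot_prod => // i; apply: pure_power_in.
Qed.

Lemma Veronese_in f :
  (forall m, m \in msupp f -> (L %| wt w m)%N) -> K (inFrac f).
Proof.
move=> fL; rewrite [f]mpolyE /inFrac rmorph_sum big_seq.
apply: big_ind => [||m mf].
- by rewrite -inFrac0; apply: Quot_incl => //; rewrite -mpolyC0.
- exact: QuotD.
rewrite -mul_mpolyC rmorphM; apply: QuotM => //; first exact: Quot_incl.
by apply: monomial_in; apply: fL.
Qed.

End Birational.

Section VeroneseAlgebra.
Variables (k : fieldType) (n : nat) (w a : 'I_n -> nat) (L : nat).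
Local Notation R := {mpoly k[n]}.
Hypothesis a_gt0 : forall i, (0 < a i)%N.
Hypothesis waL : forall i, (w i * a i)%N = L.
Hypothesis L_gt0 : (0 < L)%N.
Variables (c : 'X_{1..n}) (q : nat).
Hypothesis wt_c : wt w c = (1 + L * q)%N.
Variable I : R -> Prop.
Hypothesis I_powers : forall i, I ('X_i ^+ a i).

Local Notation v := (restrict_val (@rees_val k n w L)).
Local Notation C1 := (C_comp I v L 1).

Lemma restrict_val_mon m : v 'X_[m] = (wt w m)%:Z.
Proof.
have X0 : ('X_[m] : R)%:P != 0 by rewrite polyC_eq0 -msupp_eq0 msuppX.
rewrite /restrict_val rees_val_inFrac //; apply: mval_eq => //.
by apply/supp_inC => m'; rewrite msuppX inE => /eqP ->.
Qed.

Lemma v_homogP j f :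
  v_homog v (L%:Z *+ j) f <-> forall m, m \in msupp f -> wt w m = (L * j)%N.
Proof.
have E (m : 'X_{1..n}) : \sum_(i < n) v 'X_i *+ m i = (wt w m)%:Z.
  rewrite /wt (big_morph Posz PoszD (erefl _)); apply: eq_bigr => i _.
  by rewrite restrict_val_mon wt1 -mulr_natr natz.
by split=> h m /h; rewrite E -mulr_natr natz; lia.
Qed.

(** Homogeneity of degree L j already forces membership in the integral
    closure of I^j, so C_j is spanned by the monomials of weight L j. *)
Lemma C_compP j f :
  C_comp I v L j f <-> forall m, m \in msupp f -> wt w m = (L * j)%N.
Proof.
split=> [[_ /v_homogP //]|fj]; split; last exact/v_homogP.
by apply: (mem_int_closure waL) => // m /fj ->.
Qed.

Lemma C_veroneseP f :
  C_veronese I v L 1 f <-> forall m, m \in msupp f -> (L %| wt w m)%N.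
Proof.
split=> [[M [g Cg ->]] m|fL].
  move=> /msupp_sum_le /flattenP[s /mapP[j _ ->]].
  by have /C_compP := Cg j => h /h ->; apply: dvdn_mulr.
(* A bound above every degree j with L j the weight of a monomial of f. *)
pose M := (\sum_(m <- msupp f) wt w m).+1.
exists M, (fun j => (homog_part w L (L * j)%N f%:P)`_0).
  move=> j; apply/C_compP => m; rewrite mul1n.
  by move=> /homog_partP; rewrite /bideg; lia.
apply/mpolyP => m; rewrite raddf_sum /=.
under eq_bigr => j _ do rewrite coef_homog_part coefC eqxx /bideg muln0 subr0.
have [mf|mf] := boolP (m \in msupp f); last first.
  by rewrite (memN_msupp_eq0 mf) big1 // => j _; rewrite if_same.
have /dvdnP[j mj] := fL m mf.
have jM : (j < M)%N.
  rewrite ltnS (big_rem m) //= mj; apply: leq_trans (leq_addr _ _).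
  exact: leq_pmulr.
rewrite (bigD1 (Ordinal jM)) //= mj mulnC eqxx big1 ?addr0 // => i ij.
case: eqP => // -[/eqP]; rewrite eqn_pmul2l // => /eqP E.
by move: ij; rewrite -val_eqE /= -E eqxx.
Qed.

Lemma subalg_veronese f : subalg_gen C1 f -> C_veronese I v L 1 f.
Proof.
move=> Bf; apply/C_veroneseP.
elim: Bf => {f} [f /C_compP fL|x|f g _ IHf _ IHg|f g _ IHf _ IHg] m.
- by move/fL ->; apply: dvdn_mulr.
- by rewrite msuppC; case: eqP => // _; rewrite inE => /eqP ->; rewrite wt0.
- by move/msuppD_le; rewrite mem_cat => /orP[/IHf|/IHg].
move/msuppM_le/allpairsP => [[m1 m2] /= [/IHf h1 /IHg h2 ->]].
by rewrite wtD dvdn_add.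
Qed.

(** Both sides are fields of fractions of subrings of R, and Quot(k[C_1])
    contains C, of which k[C_1] is a subring. *)
Lemma birational_at1 : birational_at I v L 1.
Proof.
have K_in f : C_veronese I v L 1 f -> Quot (subalg_gen C1) (inFrac f).
  move=> /C_veroneseP fL.
  apply: (Veronese_in (w := w) (a := a) (L := L) a_gt0 waL wt_c) fL.
  - by rewrite -mpolyC1; apply: subalg_const.
  - exact: subalg_add.
  - exact: subalg_mul.
  - exact: subalg_const.
  - move=> m wm; apply: subalg_incl; apply/C_compP => m'.
    by rewrite msuppX inE => /eqP ->; rewrite muln1.
move=> x; split=> [] [f [g [Bf Bg g0 ->]]].
  apply: Quot_div; [|exact: K_in|exact: K_in] => *; exact: subalg_mul.
by exists f, g; split=> //; apply: subalg_veronese.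
Qed.

End VeroneseAlgebra.

Lemma pure_power_closure_supp (k : fieldType) (n : nat) (w a : 'I_n -> nat)
    (L : nat) (waL : forall i, (w i * a i)%N = L) (f : {mpoly k[n]}) :
  int_closure (pure_power_ideal a) f ->
  supp_in w L (fun d : int => L%:Z <= d) f%:P.
Proof.
apply: int_closure_supp; apply: ideal_gen_ind => [|f1 f2|b _ _ [i ->]].
- exact: supp_in0.
- by rewrite polyCD; apply: supp_inD.
rewrite polyCM; apply: supp_inM _ (@geq_suppC k n w L b) _.
  by move=> d e; apply: ler_wpDl.
apply/supp_inC => m; rewrite mpolyXn msuppX inE => /eqP ->.
by rewrite wtMn wt1 waL.
Qed.

Theorem corollary5p6 (k : fieldType) (n : nat) (n_gt0 : (0 < n)%N)
    (a : 'I_n -> nat) (a_gt0 : forall i, (0 < a i)%N)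
    (I : {mpoly k[n]} -> Prop)
    (I_monomial : monomial_ideal I)
    (I_lower : forall f, pure_power_ideal a f -> I f)
    (I_upper : forall f, I f -> int_closure (pure_power_ideal a) f) :
  exists v : {fraction {poly {mpoly k[n]}}} -> int,
    [/\ is_Rees_valuation I v,
        forall w, is_Rees_valuation I w -> forall x, x != 0 -> w x = v x
      & birational_Veronese_index I (restrict_val v) 1].
Proof.
set L := lcm_exp a; set w := weight a.
have L_gt0 : (0 < L)%N := lcm_exp_gt0 a_gt0.
have waL : forall i, (w i * a i)%N = L := weight_mul a.
have [c [q wt_c]] := weight_combination n_gt0 a_gt0.
have I_powers i : I ('X_i ^+ a i).
  apply: I_lower; rewrite -['X_i ^+ _]mul1r.
  by apply: ideal_gen_incl => //; exists i.
have I_supp f : I f -> supp_in w L (fun d : int => L%:Z <= d) f%:P.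
  by move=> /I_upper; apply: pure_power_closure_supp.
exists (@rees_val k n w L); split.
- exact: (rees_val_is_Rees_valuation n_gt0 waL L_gt0 wt_c).
- exact: (Rees_valuation_unique n_gt0 waL L_gt0 wt_c).
exists L%:Z; last first.
  by split=> //; apply: (birational_at1 a_gt0 waL L_gt0 wt_c).
split=> [|f If f0].
  pose i := Ordinal n_gt0; exists ('X_i ^+ a i); split=> //.
    by rewrite mpolyXn -msupp_eq0 msuppX.
  by rewrite mpolyXn restrict_val_mon wtMn wt1 waL.
have p0 : f%:P != 0 by rewrite polyC_eq0.
rewrite /restrict_val rees_val_inFrac //; apply/mval_geP => //.
exact: I_supp.
Qed.
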